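(* Let $x_1,\dots,x_N\in\mathbb R^d$ be distinct and suppose that the restriction of the evaluation map $f\mapsto(f(x_1),\dots,f(x_N))$ to the space of affine functions $\mathrm{Aff}(\mathbb R^d)=\{x\mapsto w^{\mathsf T}x-b: w\in\mathbb R^d,b\in\mathbb R\}$ is injective. Let $G:\mathbb R^N\to[0,+\infty]$ be proper, lower semicontinuous, and coercive. Let $\mathrm{RTV}^2$ be the extended representation cost, constructed in $\mathrm{Lip}(\mathbb R^d)$, of shallow ReLU networks with an unpenalized affine skip connection and weight-decay parameter cost, and let $\mathrm{RBV}^2(\mathbb R^d)=\{f\in\mathrm{Lip}(\mathbb R^d):\mathrm{RTV}^2(f)<+\infty\}$ be its native space. For $\lambda>0$, consider $$\min_{f\in\mathrm{RBV}^2(\mathbb R^d)}G\big(f(x_1),\dots,f(x_N)\big)+\lambda\,\mathrm{RTV}^2(f).\qquad(\mathrm P)$$ Then the solution set is nonempty and there exists a minimizer $f^\star$ of $(\mathrm P)$ of the form $$f^\star(x)=\sum_{j=1}^Kv_j(w_j^{\mathsf T}x-b_j)_++w_0^{\mathsf T}x-b_0,\qquad x\in\mathbb R^d,\quad K\le N,$$ for some $v_1,\dots,v_K\in\mathbb R$, $w_0,\dots,w_K\in\mathbb R^d$, $b_0,\dots,b_K\in\mathbb R$. Moreover, for every $K\ge N$, the problem $$\min_{\theta}\ G\big(f_\theta(x_1),\dots,f_\theta(x_N)\big)+\frac\lambda2\sum_{j=1}^K\big(|v_j|^2+\|w_j\|_2^2\big),$$ over $\theta=((w_0,b_0),(v_1,w_1,b_1),\dots,(v_K,w_K,b_K))$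 with $f_\theta(x)=\sum_{j=1}^Kv_j(w_j^{\mathsf T}x-b_j)_++w_0^{\mathsf T}x-b_0$, has a nonempty solution set, and for any solution $\theta^\star$ of it, $f_{\theta^\star}$ is a solution of $(\mathrm P)$.
   Context: **Shallow networks.** $\Theta$ is the set of parameters $\theta=((w_0,b_0),(v_1,w_1,b_1),\dots,(v_K,w_K,b_K))$ with arbitrary $K\in\mathbb N$, $v_j,b_j\in\mathbb R$, $w_j\in\mathbb R^d$; $f_\theta(x)=\sum_{j=1}^Kv_j(w_j^{\mathsf T}x-b_j)_++w_0^{\mathsf T}x-b_0$ with $(t)_+=\max\{0,t\}$; $C(\theta)=\frac12\sum_{j=1}^K(|v_j|^2+\|w_j\|_2^2)$. **Lipschitz space and weak\* topology.** $\mathrm{Lip}(\mathbb R^d)$ is the space of real Lipschitz functions (Euclidean metric), base point $0$, norm $\max\{|f|_{\mathrm{Lip}},|f(0)|\}$. The Arens–Eells space $\mathrm{AE}(\mathbb R^d)$ is the completion of the span of $\{\delta_x-\delta_y\}$ under $\|m\|=\inf\{\sum_i|a_i|\,\|x_i-y_i\|_2: m=\sum_ia_i(\delta_{x_i}-\delta_{y_i})\}$; it is the predual of the Lipschitz functions vanishing at $0$, via $\langle\sum_ia_i(\delta_{x_i}-\delta_{y_i}),g\rangle=\sum_ia_i(g(x_i)-g(y_i))$. $\mathrm{Lip}(\mathbb R^d)$ is isometrically the dual of $\mathrm{AE}(\mathbb R^d)\oplus_1\mathbb R$, and $w^*$ is the corresponding weak\* topology. **Extended representation cost.** $R_\Theta(f)=\inf\{C(\theta):\theta\in\Theta,\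 f_\theta=f\}$ for $f\in\mathrm{Lip}(\mathbb R^d)$ ($\inf\varnothing=+\infty$). $\mathrm{RTV}^2:=R$ is the $w^*$-l.s.c. regularization of $R_\Theta$: the largest $w^*$-lower semicontinuous function on $\mathrm{Lip}(\mathbb R^d)$ bounded above by $R_\Theta$. $G$ coercive means its sublevel sets are bounded; proper means finite somewhere. *)

(* Defs.v *)
From HB Require Import structures.
From mathcomp Require Import all_boot all_order all_algebra.
From mathcomp Require Import all_classical all_reals all_analysis.
Import Order.TTheory GRing.Theory Num.Theory.
Import numFieldNormedType.Exports.

Set Implicit Arguments.
Unset Strict Implicit.
Unset Printing Implicit Defensive.

Local Open Scope classical_set_scope.
Local Open Scope ring_scope.

(* The library norm `|x| on 'rV[R]_d is the sup norm, hence the explicit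
   Euclidean norm below. *)
Definition dot (R : realType) (d : nat) (u v : 'rV[R]_d) : R :=
  (u *m v^T) 0 0.

Definition enorm (R : realType) (d : nat) (u : 'rV[R]_d) : R :=
  Num.sqrt (dot u u).

Definition affine_functions (R : realType) (d : nat) : set ('rV[R]_d -> R) :=
  [set g | exists (w : 'rV[R]_d) (b : R), g = fun x => dot w x - b].
Arguments affine_functions : clear implicits.

Definition evaluation (R : realType) (d N : nat) (x : 'I_N -> 'rV[R]_d)
  (f : 'rV[R]_d -> R) : 'rV[R]_N := \row_i f (x i).

Definition is_lipschitz (R : realType) (d : nat) (f : 'rV[R]_d -> R) : Prop :=
  exists L : R, forall x y, `|f x - f y| <= L * enorm (x - y).

Record Lip (R : realType) (d : nat) := MkLip {
  lip_fun :> 'rV[R]_d -> R;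
  lip_funP : is_lipschitz lip_fun }.
Arguments Lip : clear implicits.

HB.instance Definition _ (R : realType) (d : nat) := gen_eqMixin (Lip R d).
HB.instance Definition _ (R : realType) (d : nat) := gen_choiceMixin (Lip R d).

(* The formal sum of a_i (delta_{x_i} - delta_{y_i}), as the sequence of the
   triples (a_i, x_i, y_i). *)
Definition molecule (R : realType) (d : nat) : Type :=
  seq (R * 'rV[R]_d * 'rV[R]_d).
Arguments molecule : clear implicits.

Definition dirac_fun (R : realType) (d : nat) (x : 'rV[R]_d) : 'rV[R]_d -> R :=
  fun z => (z == x)%:R.

(* The element of the span represented by a formal sum. *)
Definition mol_val (R : realType) (d : nat) (s : molecule R d) :
    'rV[R]_d -> R :=
  fun z => \sum_(t <- s) t.1.1 * (dirac_fun t.1.2 z - dirac_fun t.2 z).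

Definition mol_length (R : realType) (d : nat) (s : molecule R d) : R :=
  \sum_(t <- s) `|t.1.1| * enorm (t.1.2 - t.2).

(* Only meaningful for m in the span. *)
Definition ae_norm (R : realType) (d : nat) (m : 'rV[R]_d -> R) : R :=
  inf [set mol_length s | s in [set s : molecule R d | mol_val s = m]].

Definition mol_pairing (R : realType) (d : nat) (s : molecule R d)
    (g : 'rV[R]_d -> R) : R :=
  \sum_(t <- s) t.1.1 * (g t.1.2 - g t.2).

(* The Arens-Eells space, each point of the completion being given by the
   Cauchy sequences converging to it. They are not quotiented: the pairing with
   a Lipschitz function only depends on the limit, so the weak* topology below
   is the same. *)
Record AE (R : realType) (d : nat) := MkAE {
  ae_seq :> nat -> molecule R d;
  ae_cauchy : forall e : R, 0 < e -> exists n0, forall m n,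
    (n0 <= m)%N -> (n0 <= n)%N ->
    ae_norm (fun z => mol_val (ae_seq m) z - mol_val (ae_seq n) z) < e }.
Arguments AE : clear implicits.

(* The pairing of (u, c) in AE (+)_1 R with f, i.e. <u, f - f(0)> + c f(0);
   the constant f(0) drops out of the first term. *)
Definition lip_pairing (R : realType) (d : nat) (f : Lip R d) :
    {ptws AE R d * R -> R} :=
  fun p => limn (fun n => mol_pairing (p.1 n) f) + p.2 * f 0.

Definition weak_star (R : realType) (d : nat) : topologicalType :=
  initial_topology (@lip_pairing R d).
Arguments weak_star : clear implicits.

(* The networks of width K; Theta is the disjoint union over K. *)
Record params (R : realType) (d K : nat) := Params {
  skip_w : 'rV[R]_d;
  skip_b : R;
  outer : 'I_K -> R;
  inner : 'I_K -> 'rV[R]_d;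
  bias : 'I_K -> R }.
Arguments params : clear implicits.

Definition Theta (R : realType) (d : nat) : Type := {K : nat & params R d K}.
Arguments Theta : clear implicits.

Definition network (R : realType) (d K : nat) (theta : params R d K)
    (x : 'rV[R]_d) : R :=
  \sum_(j < K) outer theta j * Num.max 0 (dot (inner theta j) x - bias theta j)
  + dot (skip_w theta) x - skip_b theta.

Definition cost (R : realType) (d K : nat) (theta : params R d K) : R :=
  2^-1 * \sum_(j < K) (`|outer theta j| ^+ 2 + enorm (inner theta j) ^+ 2).

Lemma dot_lipschitz (R : realType) (d : nat) (w x y : 'rV[R]_d) :
  `|dot w x - dot w y| <= (\sum_i `|w 0 i|) * enorm (x - y).
Proof.
rewrite /dot !mxE -sumrB (le_trans (ler_norm_sum _ _ _))// mulr_suml.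
apply: ler_sum => i _; rewrite !mxE -mulrBr normrM ler_wpM2l//.
rewrite -sqrtr_sqr /enorm ler_wsqrtr// /dot mxE.
rewrite (bigD1 i)//= !mxE expr2 lerDl.
by apply: sumr_ge0 => j _; rewrite !mxE -expr2 sqr_ge0.
Qed.

Lemma network_lipschitz (R : realType) (d K : nat) (theta : params R d K) :
  is_lipschitz (network theta).
Proof.
exists (\sum_(j < K) `|outer theta j| * (\sum_i `|inner theta j 0 i|)
        + \sum_i `|skip_w theta 0 i|) => x y.
rewrite /network opprB addrA subrK opprD addrACA -sumrB.
rewrite (le_trans (ler_normD _ _))// mulrDl lerD ?dot_lipschitz//.
rewrite (le_trans (ler_norm_sum _ _ _))// mulr_suml.
apply: ler_sum => j _; rewrite -mulrBr normrM -mulrA ler_wpM2l//.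
apply: le_trans _ (dot_lipschitz _ _ _).
set a := dot _ x; set b := dot _ y; set c := bias _ _.
have -> : a - b = (a - c) - (b - c) by rewrite opprB addrA subrK.
have relu (s t : R) : Num.max 0 s - Num.max 0 t <= `|s - t|.
  rewrite lerBlDr ge_max addr_ge0 ?le_max ?lexx//=.
  rewrite -lerBlDr; apply: le_trans _ (ler_norm _).
  by rewrite lerD2l lerN2 le_max lexx orbT.
by rewrite ler_norml relu lerNl opprB distrC relu.
Qed.

Definition lip_network (R : realType) (d K : nat) (theta : params R d K) :
  Lip R d := MkLip (network_lipschitz theta).

Local Open Scope ereal_scope.

Definition rep_cost (R : realType) (d : nat) (f : Lip R d) : \bar R :=
  ereal_inf [set (cost (projT2 t))%:E |
    t in [set t : Theta R d | lip_network (projT2 t) = f]].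

(* A pointwise supremum of lower semicontinuous functions is one, so this is the
   largest weak*-lower semicontinuous minorant of rep_cost; see RTV2P. *)
Definition RTV2 (R : realType) (d : nat) (f : Lip R d) : \bar R :=
  ereal_sup [set h f | h in [set h : weak_star R d -> \bar R |
    lower_semicontinuous h /\ forall g, h g <= rep_cost g]].

Definition is_lsc_regularization (R : realType) (d : nat)
    (F r : Lip R d -> \bar R) : Prop :=
  [/\ lower_semicontinuous (r : weak_star R d -> \bar R),
      forall f, r f <= F f &
      forall h : weak_star R d -> \bar R, lower_semicontinuous h ->
        (forall f, h f <= F f) -> forall f, h f <= r f].

Lemma RTV2P (R : realType) (d : nat) :
  is_lsc_regularization (@rep_cost R d) (@RTV2 R d).
Proof.
split=> [f a /ereal_sup_gt[_ [h [hl hle] <-]] /hl[V fV aV] | f | h hl hle f].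
- exists V => // g /aV /lt_le_trans; apply.
  by apply: ereal_sup_ubound; exists h.
- by apply: ge_ereal_sup => _ [h [_ hle] <-].
- by apply: ereal_sup_ubound; exists h.
Qed.

Definition RBV2 (R : realType) (d : nat) : set (Lip R d) :=
  [set f | RTV2 f < +oo].
Arguments RBV2 : clear implicits.

Definition proper_fun (R : realType) (T : Type) (G : T -> \bar R) : Prop :=
  exists y, G y < +oo.

Definition coercive (R : realType) (N : nat) (G : 'rV[R]_N -> \bar R) : Prop :=
  forall c : R, bounded_set [set y | G y <= c%:E].

Definition minimizers (R : realType) (T : Type) (A : set T) (J : T -> \bar R) :
    set T :=
  [set f | A f /\ forall g, A g -> J f <= J g].

(* Main.v *)
(* Fix the data x_1, ..., x_N and let m(y) be the infimum of the costs of the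
   networks, of any width, taking the values y on the data. Everything reduces to
   a finite-dimensional problem for m.
   If the width exceeds N, the output vectors of the neurons on the data are
   linearly dependent in R^N, and rescaling the neurons along a dependence kills
   one of them without increasing the cost; so width N suffices. A neuron whose
   bias is too large acts on the data as an affine function and can be moved to the
   skip connection. Hence networks of bounded cost with bounded values on the data
   may be taken in a compact box, injectivity on affine functions bounding the
   skip connection. Therefore m is lower semicontinuous and G o ev + lambda C is
   minimized by some network of width N.
   As point evaluations are weak*-continuous, f |-> m(f(x_1), ..., f(x_N)) is a
   weak*-lower semicontinuous minorant of the representation cost, hence lies
   below RTV2, while RTV2 f_theta <= C(theta). The values of all the minimization
   problems thus coincide. *)
Require Import Defs.
From mathcomp Require Import all_boot all_order all_algebra.
From mathcomp Require Import all_classical all_reals all_analysis.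
From mathcomp Require Import ring lra.
Import Order.TTheory GRing.Theory Num.Theory.
Import numFieldNormedType.Exports.
Local Open Scope classical_set_scope.
Local Open Scope ring_scope.

(** * Lower semicontinuity and compactness *)

Section Semicontinuity.
Context {R : realType}.
Local Open Scope ereal_scope.

Lemma ereal_between (a b : \bar R) : a < b -> exists r : R, a < r%:E < b.
Proof.
case: a => [a| |]; case: b => [b| |]//=; rewrite ?lte_fin => ab.
- by exists ((a + b) / 2)%R; rewrite !lte_fin !midf_lt.
- by exists (a + 1)%R; rewrite lte_fin ltrDl ltr01 ltry.
- by exists (b - 1)%R; rewrite lte_fin gtrBl ltr01 ltNyr.
- by exists 0%R; rewrite ltNyr ltry.
Qed.

(** A minimizing sequence clusters at some [u] in [A]. If [J u] exceeded the infimum, [J] would stay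
    above some real strictly between the two near [u], whereas the sequence eventually falls below
    it. *)
Lemma lsc_attains_min (T : topologicalType) (A : set T) (J : T -> \bar R) :
  compact A -> A !=set0 -> lower_semicontinuous J ->
  exists u, A u /\ forall v, A v -> J u <= J v.
Proof.
move=> cA [u0 Au0] lJ.
have /ereal_inf_seq[v Sv vcvg] : J @` A != set0.
  by apply/set0P; exists (J u0), u0.
have /choice[w wP] : forall n, exists t, A t /\ J t = v n.
  by move=> n; have [t At <-] := Sv n; exists t.
have [|u [Au uw]] := cA (w @ \oo) _.
  by exists 0%N => // n _; have [] := wP n.
exists u; split=> // t At; apply: (@le_trans _ _ (ereal_inf (J @` A))); last first.
  by apply: ereal_inf_lbound; exists t.
rewrite leNgt; apply/negP => /ereal_between[a /andP[ia /lJ[V uV aV]]].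
have [|z [/= za /aV]] := uw [set z | J z < a%:E] V _ uV; last first.
  by rewrite ltNge (ltW za).
have : nbhs (ereal_inf (J @` A)) [set z | z < a%:E].
  by apply: open_nbhs_nbhs; split => //; exact: open_ereal_lt_ereal.
move=> /vcvg va; suff: \forall n \near \oo, J (w n) < a%:E by [].
near=> n; have [_ ->] := wP n; near: n; exact: va.
Unshelve. all: by end_near. Qed.

Lemma lsc_add_continuous (T U : topologicalType) (G : U -> \bar R)
    (e : T -> U) (c : T -> R) :
  (forall y, 0 <= G y) ->
  lower_semicontinuous G -> continuous e -> continuous c ->
  lower_semicontinuous (fun t => G (e t) + (c t)%:E).
Proof.
move=> G0 lG ce cc t a.
(* The real [b] splits the threshold [a]: near [t], [G (e s)] stays above [b] and [c s] above
   [a - b]. *)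
rewrite -lteBlDr// -EFinB => /ereal_between[b /andP[ab /lG[V eV bV]]].
have cV : nbhs t [set s | (a - b < c s)%R].
  apply: (cc t [set r | (a - b < r)%R]).
  apply: open_nbhs_nbhs; split; first exact: open_gt.
  by move: ab; rewrite lte_fin /= ltrBlDr ltrBlDl addrC.
exists ([set s | (a - b < c s)%R] `&` e @^-1` V).
  by apply: filterI => //; exact: ce.
move=> s [/= ac /bV be]; rewrite -lteBlDr// -EFinB (le_lt_trans _ be)//.
by rewrite lee_fin; move: ac; rewrite ltrBlDr => /ltW; rewrite -lerBlDl.
Qed.

Lemma row_continuous (T : topologicalType) n (e : 'I_n -> T -> R) :
  (forall i, continuous (e i : T -> R)) ->
  continuous (fun t => \row_i e i t : 'rV[R]_n).
Proof.
move=> ce t A [P tP sPA].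
have : \forall s \near t, forall i, P 0%R i (e i s).
  apply: filter_forall => i; apply: (ce i); have := tP 0%R i.
  by rewrite mxE.
by apply: filterS => s Ps; apply: sPA => i j; rewrite ord1 mxE.
Qed.

End Semicontinuity.

(** * Euclidean inner product and parameter cost *)

Section Networks.
Context {R : realType} {d : nat}.
Implicit Types (u v w z : 'rV[R]_d).

Lemma dotE u v : dot u v = \sum_k u 0 k * v 0 k.
Proof. by rewrite /dot mxE; apply: eq_bigr => k _; rewrite mxE. Qed.

Lemma dotDl u v z : dot (u + v) z = dot u z + dot v z.
Proof. by rewrite /dot mulmxDl mxE. Qed.

Lemma dotZl a u z : dot (a *: u) z = a * dot u z.
Proof. by rewrite /dot -scalemxAl mxE. Qed.

Lemma dot0l z : dot 0 z = 0.
Proof. by rewrite /dot mul0mx mxE. Qed.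

Lemma dot0r u : dot u 0 = 0.
Proof. by rewrite /dot trmx0 mulmx0 mxE. Qed.

Lemma dot_suml (I : finType) (F : I -> 'rV[R]_d) z :
  dot (\sum_i F i) z = \sum_i dot (F i) z.
Proof. by rewrite /dot mulmx_suml summxE. Qed.

Lemma enorm_sqr u : enorm u ^+ 2 = dot u u.
Proof.
rewrite sqr_sqrtr// dotE; apply: sumr_ge0 => k _.
by rewrite -expr2 sqr_ge0.
Qed.

Lemma enormZ_sqr a u : enorm (a *: u) ^+ 2 = a ^+ 2 * enorm u ^+ 2.
Proof.
rewrite !enorm_sqr dotZl expr2 -mulrA; congr (_ * _).
by rewrite !dotE mulr_sumr; apply: eq_bigr => k _; rewrite mxE; ring.
Qed.

Lemma enorm0_sqr : enorm (0 : 'rV[R]_d) ^+ 2 = 0.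
Proof. by rewrite enorm_sqr dot0l. Qed.

Lemma cost_ge0 {K} (t : params R d K) : 0 <= cost t.
Proof.
rewrite mulr_ge0// ?invr_ge0//; apply: sumr_ge0 => j _.
by rewrite addr_ge0// sqr_ge0.
Qed.

(** * Reducing the width to the number of data points *)

Context {N : nat} (x : 'I_N -> 'rV[R]_d).

Local Notation fit t := (evaluation x (network t)).

(** More rows than columns give a nonzero dependence [c], whose sign can be chosen. A negative
    weighted sum forces a negative coefficient since [E] is nonnegative; if the sum vanishes, [c] or
    [- c] has one. *)
Lemma conic_dependence n (A : 'M[R]_(n, N)) (E : 'I_n -> R) :
  (N < n)%N -> (forall j, 0 <= E j) ->
  exists c : 'rV[R]_n, [/\ c *m A = 0, \sum_j c 0 j * E j <= 0 &
    exists j, c 0 j < 0].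
Proof.
move=> Nn E0.
have [c c0 cA] : exists2 c : 'rV[R]_n, c != 0 & c *m A = 0.
  have : ~~ row_free A.
    by rewrite /row_free neq_ltn (leq_ltn_trans (rank_leq_col A)).
  rewrite -kermx_eq0 => /rowV0Pn[c /sub_kermxP cA c0].
  by exists c.
have [j cj] : exists j, c 0 j != 0.
  apply/existsP; apply: contra_neqT c0 => /existsPn c0.
  by apply/rowP => j; rewrite mxE; apply/eqP; have := c0 j; rewrite negbK.
have key (b : 'rV[R]_n) : b *m A = 0 -> \sum_j b 0 j * E j < 0 ->
    exists c : 'rV[R]_n, [/\ c *m A = 0, \sum_j c 0 j * E j <= 0 &
    exists j, c 0 j < 0].
  move=> bA bE; exists b; split=> //; first exact: ltW.
  apply/existsP; rewrite -[X in is_true X]negbK; apply/negP => /existsPn b0.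
  move: bE; rewrite ltNge sumr_ge0// => i _.
  by rewrite mulr_ge0// leNgt b0.
have SN : \sum_j (- c) 0 j * E j = - \sum_j c 0 j * E j.
  by rewrite -sumrN; apply: eq_bigr => i _; rewrite mxE mulNr.
have [/key|S0|S0] := ltgtP (\sum_j c 0 j * E j) 0; first exact.
  by apply: (key (- c)); rewrite ?mulNmx ?cA ?oppr0// SN oppr_lt0.
have [cj0|cj0] := ltP (c 0 j) 0.
  by exists c; split; [|rewrite S0|exists j].
exists (- c); split; rewrite ?mulNmx ?cA ?oppr0 ?SN ?S0//.
by exists j; rewrite mxE oppr_lt0 lt_neqAle eq_sym cj.
Qed.

(* Multiplying the three parameters of a neuron by the square root of a factor
   multiplies both its output and its cost by that factor. *)
Lemma drop_neuron K (t : params R d K.+1) : (N <= K)%N ->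
  exists t' : params R d K, fit t' = fit t /\ cost t' <= cost t.
Proof.
move=> NK.
pose r j (z : 'rV[R]_d) : R := Num.max 0 (dot (inner t j) z - bias t j).
pose E j : R := `|outer t j| ^+ 2 + enorm (inner t j) ^+ 2.
pose A : 'M[R]_(K.+1, N) := \matrix_(j, i) (outer t j * r j (x i)).
have E0 j : 0 <= E j by rewrite addr_ge0 ?sqr_ge0.
have [c [cA cE [j0 cj0]]] := @conic_dependence _ A E NK E0.
(* As [c 0 j] is the smallest coefficient, and negative, the factors [1 - c 0 i / c 0 j] are
   nonnegative and vanish at [j]. They preserve the fit because [c *m A = 0], and they lower the
   cost by a quotient of two nonpositive numbers. *)
pose j := [arg min_(i < j0) c 0 i]%O.
have [cj cle] : c 0 j < 0 /\ forall i, c 0 j <= c 0 i.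
  rewrite /j; case: arg_minP => // k _ kle; split=> [|i]; last exact: kle.
  exact: le_lt_trans (kle _ isT) cj0.
pose a i := 1 - c 0 i / c 0 j.
have a0 i : 0 <= a i by rewrite subr_ge0 ler_ndivrMr// mul1r.
have aj : a j = 0 by rewrite /a divff ?subrr// lt_eqF.
pose s i := Num.sqrt (a i).
have ss i : s i * s i = a i by rewrite -expr2 sqr_sqrtr.
exists (Params (skip_w t) (skip_b t) (fun i => s (lift j i) * outer t (lift j i))
  (fun i => s (lift j i) *: inner t (lift j i))
  (fun i => s (lift j i) * bias t (lift j i))); split.
  apply/rowP => i; rewrite !mxE /network/=; congr (_ + _ - _).
  transitivity (\sum_k a k * A k i).
    rewrite [RHS](bigD1_ord j)//= aj mul0r add0r; apply: eq_bigr => k _.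
    rewrite dotZl -mulrBr -[X in Num.max X _](mulr0 (s (lift j k))).
    by rewrite -maxr_pMr ?sqrtr_ge0// -ss mxE /r; ring.
  transitivity (\sum_k A k i - (c *m A) 0 i / c 0 j).
    rewrite mxE mulr_suml -sumrB; apply: eq_bigr => k _; rewrite /a; ring.
  rewrite cA mxE mul0r subr0; apply: eq_bigr => k _; by rewrite mxE.
rewrite /cost ler_wpM2l ?invr_ge0//.
rewrite [leLHS](_ : _ = \sum_k a k * E k); last first.
  rewrite [RHS](bigD1_ord j)//= aj mul0r add0r; apply: eq_bigr => k _.
  rewrite enormZ_sqr normrM exprMn (real_normK (num_real (s _))) expr2 ss /E.
  by ring.
rewrite [leLHS](_ : _ = \sum_k E k - (\sum_k c 0 k * E k) / c 0 j).
  by rewrite gerBl mulr_le0// invr_le0 ltW.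
by rewrite mulr_suml -sumrB; apply: eq_bigr => k _; rewrite /a; ring.
Qed.

Lemma pad_neuron K (t : params R d K) :
  exists t' : params R d K.+1, fit t' = fit t /\ cost t' <= cost t.
Proof.
pose f T (z : T) (g : 'I_K -> T) (j : 'I_K.+1) := oapp g z (unlift ord0 j).
exists (Params (skip_w t) (skip_b t) (f R 0 (outer t))
  (f _ 0 (inner t)) (f R 0 (bias t))); split.
  apply/rowP => i; rewrite !mxE /network/= big_ord_recl/= /f unlift_none/=.
  rewrite mul0r add0r; congr (_ + _ - _); apply: eq_bigr => k _.
  by rewrite liftK.
rewrite /cost/= big_ord_recl/= /f unlift_none/= normr0 enorm0_sqr expr0n/= !add0r.
by under eq_bigr do rewrite liftK.
Qed.

(** Zero neurons pad a narrow network; a wide one loses neurons one at a time, which [drop_neuron]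
    permits while the width exceeds [N]. *)
Lemma resize K K' (t : params R d K) : (N <= K')%N ->
  exists t' : params R d K', fit t' = fit t /\ cost t' <= cost t.
Proof.
move=> NK'; have [KK'|KK'] := leqP K K'.
  rewrite -(subnK KK'); elim: (K' - K)%N => [|n [t' [<- le]]].
    by exists t.
  rewrite addSn; have [t'' [<- le']] := pad_neuron _ t'.
  by exists t''; split => //; exact: le_trans le.
move: t; rewrite -(subnK (ltnW KK')); elim: (K - K')%N => [|n IH] t.
  by exists t.
have [|t' [<- le]] := drop_neuron _ t.
  by rewrite (leq_trans NK')// leq_addl.
by have [t'' [<- le']] := IH t'; exists t''; split=> //; exact: le_trans le.
Qed.


(** * Confining the biases *)

Definition spread {K} (t : params R d K) j : R :=
  \sum_i `|dot (inner t j) (x i)|.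

Lemma dot_le_spread {K} (t : params R d K) j i :
  `|dot (inner t j) (x i)| <= spread t j.
Proof. by rewrite /spread (bigD1 i)//= lerDl sumr_ge0. Qed.

(** A neuron violating this bound lies on the same side of its kink at all data points. *)
Definition confined {K} (t : params R d K) :=
  forall j, `|bias t j| <= spread t j.

(* A neuron that is not confined is zero or affine on the data; in the second
   case it is moved to the skip connection. *)
Lemma confine K (t : params R d K) :
  exists t' : params R d K, [/\ fit t' = fit t, cost t' <= cost t & confined t'].
Proof.
pose ins j := `|bias t j| <= spread t j.
pose neg j := bias t j < - spread t j.
pose sel (V : nmodType) (b : 'I_K -> bool) (g : 'I_K -> V) j :=
  if b j then g j else 0.
exists (Params (skip_w t + \sum_j sel _ neg (fun j => outer t j *: inner t j) j)
  (skip_b t + \sum_j sel _ neg (fun j => outer t j * bias t j) j)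
  (sel _ ins (outer t)) (sel _ ins (inner t)) (sel _ ins (bias t))); split.
- apply/rowP => i; rewrite !mxE /network/= dotDl dot_suml.
  set P := \sum_j _ * Num.max _ _; set Q := \sum_j dot _ _; set S := \sum_j _.
  rewrite (_ : \sum_(j < K) _ = P + Q - S); first ring.
  rewrite /P /Q /S -big_split -sumrB/=; apply: eq_bigr => j _.
  rewrite /sel /ins /neg; have := dot_le_spread t j i.
  rewrite !ler_norml => /andP[h1 h2].
  have [lo|lo] := ltP (bias t j) (- spread t j).
    rewrite /= dotZl mul0r add0r max_r; first ring.
    by rewrite subr_ge0 ltW// (lt_le_trans lo).
  rewrite /= dot0l.
  have [hi|hi] := leP (bias t j) (spread t j); rewrite ?addr0 ?subr0//.
  rewrite mul0r max_l ?mulr0//; by rewrite subr_le0 (le_trans h2)// ltW.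
(* The skip connection is free, and each neuron is either kept or set to zero. *)
- rewrite /cost ler_wpM2l ?invr_ge0// ler_sum// => j _/=.
  rewrite /sel; case: ifP => // _.
  by rewrite normr0 enorm0_sqr expr0n/= addr0 addr_ge0 ?sqr_ge0.
move=> j; rewrite /spread/= /sel; case: ifP => // _.
by rewrite normr0 sumr_ge0.
Qed.

(** * Bounding the parameters *)

(** The matrix of [evaluation x] on affine functions, each given by the row of its coefficients [w]
    and [b]; the entries [-1] come from the sign of [b]. *)
Definition affine_mx : 'M[R]_(d + 1, N) :=
  col_mx (\matrix_(k, i) x i 0 k) (const_mx (-1)).

Lemma mul_affine_mx w (b : R) i :
  (row_mx w b%:M *m affine_mx) 0 i = dot w (x i) - b.
Proof.
rewrite mul_row_col !mxE dotE big_ord1 !mxE eqxx mulr1n mulrN1.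
by congr (_ - _); apply: eq_bigr => k _; rewrite mxE.
Qed.

(** A row in the kernel is an affine function vanishing on the data, hence zero by injectivity; its
    values at the origin and at the basis vectors then give [b = 0] and [w = 0]. *)
Lemma affine_mx_free : set_inj (affine_functions R d) (evaluation x) ->
  row_free affine_mx.
Proof.
move=> inj; rewrite -kermx_eq0; apply/rowV0P => u /sub_kermxP uM.
have [w [b uE]] : exists w b, u = row_mx w b%:M.
  exists (lsubmx u), (rsubmx u 0 0); rewrite -mx11_scalar.
  by rewrite hsubmxK.
have g0 : (fun z => dot w z - b) = (fun z => dot 0 z - 0).
  apply: inj; rewrite ?inE; [by exists w, b|by exists 0, 0|].
  apply/rowP => i; rewrite !mxE -mul_affine_mx -uE uM mxE.
  by rewrite dot0l subr0.
have b0 : b = 0.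
  have := congr1 (@^~ 0) g0; rewrite /= dot0r dot0l subr0 sub0r => /eqP.
  by rewrite oppr_eq0 => /eqP.
have w0 : w = 0.
  apply/rowP => k; have := congr1 (@^~ (delta_mx 0 k)) g0.
  rewrite /= b0 dot0l !subr0 dotE (bigD1 k)//= big1 ?addr0 => [|i ik].
    by rewrite !mxE !eqxx mulr1.
  by rewrite [X in _ * X]mxE (negbTE ik) andbF mulr0.
by rewrite uE b0 w0 raddf0 row_mx0.
Qed.

(** Parameters are flattened to families of reals, so that their space is a power of [R], where
    boxes are compact by Tychonoff's theorem. *)
Definition param_idx (K : nat) : Type :=
  (option 'I_d + 'I_K * option (option 'I_d))%type.

Definition coords {K} (t : params R d K) (k : param_idx K) : R :=
  match k with
  | inl (Some k) => skip_w t 0 k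
  | inl None => skip_b t
  | inr (j, None) => outer t j
  | inr (j, Some None) => bias t j
  | inr (j, Some (Some k)) => inner t j 0 k
  end.

Definition of_coords {K} (u : param_idx K -> R) : params R d K :=
  Params (\row_k u (inl (Some k))) (u (inl None))
    (fun j => u (inr (j, None)))
    (fun j => \row_k u (inr (j, Some (Some k))))
    (fun j => u (inr (j, Some None))).

Lemma coordsK K : cancel (@coords K) of_coords.
Proof.
case=> w b v W B; rewrite /of_coords/=; congr Params; last apply/funext => j.
  by apply/rowP => k; rewrite mxE.
by apply/rowP => k; rewrite mxE.
Qed.

(** The cost bounds the outer and inner weights, and confinement then bounds the biases. Subtracting
    the neurons from the fit leaves a bounded affine part, whose coefficients are recovered through
    the pseudo-inverse of [affine_mx]. *)
Lemma coords_bounded K (a B : R) :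
  set_inj (affine_functions R d) (evaluation x) ->
  exists D : R, forall t : params R d K, confined t -> cost t <= a ->
    (forall i, `|fit t 0 i| <= B) -> forall k, `|coords t k| <= D.
Proof.
move=> /affine_mx_free Mfree.
(* Any [c] with [c ^+ 2 <= 2 * |a|] satisfies [|c| <= D1], because [2 * |c| <= c ^+ 2 + 1]. *)
pose D1 : R := 2 * `|a| + 1.
pose X : R := \sum_i \sum_k `|x i 0 k|.
pose P : R := \sum_i \sum_k `|pinvmx affine_mx i k|.
(* [Z] bounds the affine part on the data: [|B|] for the fit and, per neuron, [D1] times the bounds
   [D1 * X] of the inner product and of the bias. *)
pose Z : R := `|B| + \sum_(j < K) D1 * (D1 * X + D1 * X).
have D1_ge0 : 0 <= D1 by rewrite addr_ge0// mulr_ge0.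
have X_ge0 : 0 <= X by do 2 (apply: sumr_ge0 => ? _).
have P_ge0 : 0 <= P by do 2 (apply: sumr_ge0 => ? _).
have DX : 0 <= D1 * X by rewrite mulr_ge0.
have Z_ge0 : 0 <= Z.
  by rewrite addr_ge0//; apply: sumr_ge0 => j _; rewrite mulr_ge0// addr_ge0.
exists (D1 + D1 * X + Z * P) => t conf ta tB.
have sq j : `|outer t j| ^+ 2 + enorm (inner t j) ^+ 2 <= 2 * `|a|.
  have : 2 * cost t <= 2 * `|a| by rewrite ler_pM2l// (le_trans ta)// ler_norm.
  apply: le_trans; rewrite /cost mulrA divff// mul1r (bigD1 j)//= lerDl.
  by apply: sumr_ge0 => i _; rewrite addr_ge0 ?sqr_ge0.
have sqD1 (c : R) : c ^+ 2 <= 2 * `|a| -> `|c| <= D1.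
  rewrite /D1 -(real_normK (num_real c)) => ca; have a0 := normr_ge0 a.
  have : 0 <= `|c| ^+ 2 - 2 * `|c| + 1.
    by rewrite (_ : _ + 1 = (`|c| - 1) ^+ 2) ?sqr_ge0//; ring.
  by lra.
have outer_le j : `|outer t j| <= D1.
  apply: sqD1; rewrite -(real_normK (num_real (outer t j))).
  by apply: le_trans (sq j); rewrite lerDl sqr_ge0.
have inner_le j k : `|inner t j 0 k| <= D1.
  apply: sqD1; apply: le_trans (sq j).
  rewrite enorm_sqr dotE (bigD1 k)//= -expr2 addrCA lerDl.
  by rewrite addr_ge0 ?sqr_ge0//; apply: sumr_ge0 => i _; rewrite -expr2 sqr_ge0.
have spread_le j : spread t j <= D1 * X.
  rewrite /spread mulr_sumr ler_sum// => i _; rewrite dotE mulr_sumr.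
  rewrite (le_trans (ler_norm_sum _ _ _))// ler_sum// => k _.
  by rewrite normrM ler_wpM2r.
have bias_le j : `|bias t j| <= D1 * X := le_trans (conf j) (spread_le j).
pose u : 'rV[R]_(d + 1) := row_mx (skip_w t) (skip_b t)%:M.
have aff_le i : `|(u *m affine_mx) 0 i| <= Z.
  rewrite mul_affine_mx.
  have -> : dot (skip_w t) (x i) - skip_b t = fit t 0 i -
      \sum_j outer t j * Num.max 0 (dot (inner t j) (x i) - bias t j).
    by rewrite mxE /network; ring.
  rewrite (le_trans (ler_normB _ _))// lerD//.
    by rewrite (le_trans (tB i))// ler_norm.
  rewrite (le_trans (ler_norm_sum _ _ _))// ler_sum// => j _.
  rewrite normrM ler_pM//.
  have relu_le (c : R) : `|Num.max 0 c| <= `|c|.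
    by have [c0|c0] := leP 0 c; rewrite ?normr0.
  rewrite (le_trans (relu_le _))// (le_trans (ler_normB _ _))// lerD//.
  exact: le_trans (dot_le_spread _ _ _) (spread_le j).
have u_le k : `|u 0 k| <= Z * P.
  rewrite -[u](mulmxKp Mfree) mxE (le_trans (ler_norm_sum _ _ _))//.
  rewrite mulr_sumr ler_sum// => i _; rewrite normrM ler_pM//.
  by rewrite (bigD1 k)//= lerDl sumr_ge0.
have ZP : 0 <= Z * P by rewrite mulr_ge0.
case=> [[k|]|[j [[k|]|]]]/=.
- have := u_le (lshift 1 k); rewrite row_mxEl; lra.
- have := u_le (rshift d 0); rewrite row_mxEr mxE eqxx mulr1n; lra.
- have := inner_le j k; lra.
- have := bias_le j; lra.
- have := outer_le j; lra.
Qed.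


(** * Continuity in the parameters and compact boxes *)

Definition coord_space K : topologicalType :=
  prod_topology (fun _ : param_idx K => R).

Lemma coord_continuous K (k : param_idx K) :
  continuous (fun u : coord_space K => u k : R).
Proof. exact: (@proj_continuous _ (fun _ : param_idx K => R) k). Qed.

Lemma sum_continuous {T : topologicalType} {I : finType} {F : I -> T -> R} :
  (forall i, continuous (F i : T -> R)) ->
  continuous (fun t => \sum_i F i t : R).
Proof.
move=> cF; apply: (@continuous_big R I +%R 0 xpredT _ T) => [|i _].
  exact: add_continuous.
exact: cF.
Qed.

Lemma dot_continuous (T : topologicalType) (g : T -> 'I_d -> R) z :
  (forall k, continuous (g^~ k : T -> R)) ->
  continuous (fun t => dot (\row_k g t k) z : R).
Proof.
move=> cg; under eq_fun do rewrite dotE; apply: sum_continuous => k t.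
by under eq_fun do rewrite mxE; apply: cvgM; [exact: cg|exact: cvg_cst].
Qed.

Lemma of_coords_continuous (T : topologicalType) K (u : T -> param_idx K -> R) :
  (forall k, continuous (u^~ k : T -> R)) ->
  continuous (fun t => fit (of_coords (u t))) /\
  continuous (fun t => cost (of_coords (u t)) : R).
Proof.
move=> cu; split.
  apply: row_continuous => i.
  have c_relu j : continuous (fun t => u t (inr (j, None)) *
      Num.max 0 (dot (inner (of_coords (u t)) j) (x i)
        - u t (inr (j, Some None))) : R).
    move=> t; apply: cvgM; first exact: cu.
    apply: (@continuous_max R T (cst 0)
      (fun t => dot (inner (of_coords (u t)) j) (x i) - u t (inr (j, Some None)))).
      exact: cvg_cst.
    by apply: cvgB; [apply: dot_continuous => k|]; exact: cu.
  have c_aff : continuous (fun t => dot (skip_w (of_coords (u t))) (x i)).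
    by apply: dot_continuous => k; exact: cu.
  have c_sum := sum_continuous c_relu.
  by move=> t; exact: (cvgB (cvgD (c_sum t) (c_aff t)) (cu (inl None) t)).
have c_inner j : continuous (fun t => enorm (inner (of_coords (u t)) j) ^+ 2 : R).
  under eq_fun do rewrite enorm_sqr dotE.
  apply: sum_continuous => k t.
  by under eq_fun do rewrite !mxE; apply: cvgM; exact: cu.
have c_neuron j : continuous (fun t =>
    `|u t (inr (j, None))| ^+ 2 + enorm (inner (of_coords (u t)) j) ^+ 2 : R).
  move=> t; apply: cvgD; last exact: c_inner.
  under eq_fun do rewrite expr2.
  by apply: cvgM; apply: cvg_norm; exact: cu.
move=> t; have c_sum := sum_continuous c_neuron t.
by apply: cvgM; [exact: cvg_cst|exact: c_sum].
Qed.

Lemma fit_continuous K :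
  continuous (fun u : coord_space K => fit (of_coords u)).
Proof. exact: (of_coords_continuous _ _ _ (@coord_continuous K)).1. Qed.

Lemma cost_continuous K :
  continuous (fun u : coord_space K => cost (of_coords u) : R).
Proof. exact: (of_coords_continuous _ _ _ (@coord_continuous K)).2. Qed.

Lemma scaled_cost_continuous K (l : R) :
  continuous (fun u : coord_space K => l * cost (of_coords u) : R).
Proof.
have mulC : continuous (fun c : R => l * c) by exact: mulrl_continuous.
move=> u; apply: (@continuous_comp _ _ _
  (fun u : coord_space K => cost (of_coords u) : R) (fun c : R => l * c)).
  exact: cost_continuous.
exact: mulC.
Qed.

Definition box (D : R) : set (coord_space N) :=
  [set u | forall k, u k \in `[- D, D]].

Lemma box_compact D : compact (box D).
Proof.
apply: (@tychonoff _ (fun _ : param_idx N => R) (fun=> `[- D, D]%classic)).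
by move=> _; exact: segment_compact.
Qed.

Hypothesis aff_inj : set_inj (affine_functions R d) (evaluation x).

(** Networks are resized to width [N] before being bounded, so a single [D] serves every [K]. *)
Lemma reduce_to_box (a B : R) : exists D : R, forall K (t : params R d K),
  cost t <= a -> (forall i, `|fit t 0 i| <= B) ->
  exists u : coord_space N, [/\ box D u, fit (of_coords u) = fit t &
    cost (of_coords u) <= cost t].
Proof.
have [D DP] := coords_bounded N a B aff_inj.
exists D => K t ta tB.
have [t1 [f1 c1]] := resize _ _ t (leqnn N).
have [t2 [f2 c2 conf]] := confine _ t1.
have c2t : cost t2 <= cost t := le_trans c2 c1.
exists (coords t2); rewrite coordsK; split; rewrite ?f2// => k.
rewrite in_itv/= -ler_norml; apply: DP => //; first exact: le_trans ta.
by rewrite f2 f1.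
Qed.

(** * The least cost of fitting given values *)

Local Open Scope ereal_scope.

Definition fit_cost (y : 'rV[R]_N) : \bar R :=
  ereal_inf [set (cost (projT2 t))%:E |
    t in [set t : Theta R d | fit (projT2 t) = y]].

(** Near [y0], all values attained at cost at most [a'] lie in [F], which is closed as the image of
    a compact set and misses [y0]; off [F] the infimum is therefore at least [a']. *)
Lemma fit_cost_lsc : lower_semicontinuous fit_cost.
Proof.
move=> y0 a /ereal_between[a' /andP[aa' a'y0]].
(* [B] bounds the entries of every point of the unit ball around [y0]. *)
pose B := (\sum_i `|y0 0%R i| + 1)%R.
have [D DP] := reduce_to_box a' B.
pose F := (fun u : coord_space N => fit (of_coords u)) @`
  (box D `&` [set u : coord_space N | (cost (of_coords u) <= a')%R]).
have F_closed : closed F.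
  apply: compact_closed; first exact: norm_hausdorff.
  apply: continuous_compact.
    exact/continuous_subspaceT/fit_continuous.
  apply: compact_closedI; first exact: box_compact.
  apply: (@closed_comp _ _ _ [set c : R | (c <= a')%R]); last exact: closed_le.
  by move=> u _; exact: cost_continuous.
have Fy0 : ~ F y0.
  move=> [u [_ /= ua'] uy0]; move: a'y0; rewrite ltNge => /negP; apply.
  apply: (@le_trans _ _ (cost (of_coords u))%:E); last by rewrite lee_fin.
  by apply: ereal_inf_lbound; exists (existT _ N (of_coords u)).
exists (~` F `&` ball y0 1%R).
  apply: filterI; last exact: nbhsx_ballx.
  by apply: open_nbhs_nbhs; split => //; rewrite openC.
move=> y [Fy [_ y01]]; apply: (lt_le_trans aa').
apply: le_ereal_inf_tmp => _ [[K t] /= ty <-]; rewrite lee_fin leNgt.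
apply/negP => ta'; apply: Fy.
have [|i|u [Du uy ua]] := DP _ t; first exact: ltW.
  have := y01 0%R i; rewrite ty /ball/= /B (bigD1 i)//= => yi.
  rewrite -[y 0%R i](subrK (y0 0%R i)) (le_trans (ler_normD _ _))//.
  rewrite [leLHS]addrC -[leRHS]addrA lerD2l.
  rewrite (le_trans (y := 1%R))// ?lerDr ?sumr_ge0//.
  by rewrite distrC ltW.
by exists u; [split => //=; rewrite (le_trans ua)// ltW|rewrite uy].
Qed.

End Networks.

(** * Weak* continuity of evaluations *)

Section WeakStar.
Context {R : realType} {d : nat}.

Lemma ae_norm_zero_lt (e : R) : 0 < e -> ae_norm (fun _ : 'rV[R]_d => 0 : R) < e.
Proof.
move=> e0; apply: le_lt_trans e0; apply: ge_inf.
  exists 0 => _ [s _ <-]; apply: sumr_ge0 => t _.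
  by rewrite mulr_ge0// sqrtr_ge0.
exists [::]; rewrite /mol_length/mol_val/= ?big_nil//.
by apply/funext => z; rewrite big_nil.
Qed.

(** Makes every molecule a point of [AE], represented by a constant sequence. *)
Lemma const_ae_cauchy (s : molecule R d) (e : R) : 0 < e -> exists n0, forall m n,
  (n0 <= m)%N -> (n0 <= n)%N ->
  ae_norm (fun z => mol_val ((fun=> s) m) z - mol_val ((fun=> s) n) z) < e.
Proof.
move=> e0; exists 0%N => m n _ _; under eq_fun do rewrite subrr.
exact: ae_norm_zero_lt.
Qed.

(* The point evaluation f |-> f z is the pairing with
   (delta_z - delta_0, 1). *)
Lemma weak_star_eval_continuous (z : 'rV[R]_d) :
  continuous (fun f : weak_star R d => lip_fun f z : R).
Proof.
pose p : AE R d * R := (MkAE (const_ae_cauchy [:: (1, z, 0)]), 1).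
have pE (f : Lip R d) : lip_fun f z = lip_pairing f p.
  rewrite /lip_pairing/= /mol_pairing/=; under eq_fun do rewrite big_seq1/=.
  by rewrite lim_cst//= !mul1r subrK.
under eq_fun do rewrite pE.
move=> f; apply: (@continuous_comp _ _ _ (@lip_pairing R d : weak_star R d -> _)
  (@proj {classic AE R d * R} (fun=> R) p)).
  exact: initial_continuous.
exact: proj_continuous.
Qed.

Lemma weak_star_evaluation_continuous {N} (x : 'I_N -> 'rV[R]_d) :
  continuous (fun f : weak_star R d => evaluation x (lip_fun f)).
Proof. by apply: row_continuous => i; exact: weak_star_eval_continuous. Qed.

End WeakStar.

(** * Comparing [RTV2] with network costs *)

Local Open Scope ereal_scope.

Lemma RTV2_network_le {R : realType} {d K} (t : params R d K) :
  RTV2 (lip_network t) <= (cost t)%:E.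
Proof.
have [_ le _] := RTV2P R d; apply: le_trans (le _) _.
by apply: ereal_inf_lbound; exists (existT _ K t).
Qed.

(** Maximality of [RTV2] applies: a network representing [g] also fits its values on the data, so
    their [fit_cost] is at most [rep_cost g]. *)
Lemma fit_cost_le_RTV2 {R : realType} {d N} (x : 'I_N -> 'rV[R]_d) (f : Lip R d) :
  set_inj (affine_functions R d) (evaluation x) ->
  fit_cost x (evaluation x f) <= RTV2 f.
Proof.
move=> aff_inj; have [_ _] := RTV2P R d.
move=> /(_ (fun f : weak_star R d => fit_cost x (evaluation x (lip_fun f)))).
apply=> [g a /(fit_cost_lsc x aff_inj)[V gV aV]|g].
  exists ((fun f : weak_star R d => evaluation x (lip_fun f)) @^-1` V).
    exact: weak_star_evaluation_continuous.
  by move=> h /aV.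
apply: le_ereal_inf_tmp => _ [t /= tg <-].
by apply: ereal_inf_lbound; exists t => //=; rewrite -tg.
Qed.

(** * Minimizing the regularized loss *)

Section Minimization.
Context {R : realType} {d N : nat} (x : 'I_N -> 'rV[R]_d).
Hypothesis aff_inj : set_inj (affine_functions R d) (evaluation x).
Context (G : 'rV[R]_N -> \bar R) (lambda : R).
Hypotheses (G_ge0 : forall y, 0 <= G y) (G_lsc : lower_semicontinuous G).
Hypotheses (G_coercive : coercive G) (lambda_gt0 : (0 < lambda)%R).

Definition loss {K} (t : params R d K) : \bar R :=
  G (evaluation x (network t)) + (lambda * cost t)%:E.

(** A network no worse than one of finite loss [r] has cost at most [r / lambda] and, by coercivity,
    bounded values on the data. It can thus be replaced by one in a compact box, where [loss]
    attains its minimum. *)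
Lemma optimal_network : exists t0 : params R d N,
  forall K (t : params R d K), loss t0 <= loss t.
Proof.
(* If every loss is infinite, any network is optimal. *)
have [infty|] := pselect (forall K (t : params R d K), loss t = +oo).
  by exists (of_coords (fun=> 0%R)) => K t; rewrite (infty _ t) leey.
move=> /existsNP[K1 /existsNP[t1 t1_fin]].
have lc K (t : params R d K) : (0 <= lambda * cost t)%R.
  by rewrite mulr_ge0 ?cost_ge0// ltW.
have [r t1E] : exists r, loss t1 = r%:E.
  have : 0 <= loss t1 by rewrite adde_ge0// lee_fin.
  by case: (loss t1) t1_fin => [r| |]//; exists r.
have [M [_ MP]] := G_coercive r.
have [D DP] := reduce_to_box x aff_inj (r / lambda) (M + 1).
have to_box K (t : params R d K) : loss t <= r%:E ->
    exists2 u : coord_space N, box D u & loss (of_coords u) <= loss t.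
  move=> tr; have [||u [Du uf uc]] := DP _ t.
  - rewrite ler_pdivlMr// mulrC -lee_fin (le_trans _ tr)//.
    by rewrite leeDr.
  - move=> i; apply: le_trans (MP (M + 1)%R _ _ _) => //.
    + rewrite /Num.norm/= mx_normrE.
      exact: (le_bigmax _
        (fun ij => `|evaluation x (network t) ij.1 ij.2|%R) (0%R, i)).
    + by rewrite ltrDl.
    + by rewrite /= (le_trans _ tr)// leeDl// lee_fin.
  by exists u => //; rewrite /loss uf leeD2l// lee_fin ler_pM2l.
have [u1 Du1 u1t1] : exists2 u : coord_space N, box D u &
    loss (of_coords u) <= loss t1.
  by apply: to_box; rewrite t1E.
have [u0 [_ u0P]] : exists u0 : coord_space N, box D u0 /\
    forall u : coord_space N, box D u -> loss (of_coords u0) <= loss (of_coords u).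
  apply: (@lsc_attains_min _ (coord_space N)); first exact: box_compact.
    by exists u1.
  exact: (lsc_add_continuous _ _ _ _ _ G_ge0 G_lsc (fit_continuous x N)
    (scaled_cost_continuous x N lambda)).
exists (of_coords u0) => K t.
have [tr|/ltW rt] := leP (loss t) r%:E.
  by have [u Du ut] := to_box _ _ tr; exact: le_trans (u0P _ Du) ut.
by rewrite (le_trans (u0P _ Du1))// (le_trans u1t1)// t1E.
Qed.

(** Some network fitting [y] costs less than [fit_cost x y + e / lambda], and the excess becomes [e]
    after scaling. *)
Lemma optimal_le K (t0 : params R d K) y :
  (forall K (t : params R d K), loss t0 <= loss t) ->
  loss t0 <= G y + lambda%:E * fit_cost x y.
Proof.
move=> t0P.
have : 0 <= fit_cost x y.
  by apply: le_ereal_inf_tmp => _ [t _ <-]; rewrite lee_fin cost_ge0.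
(* If no network fits [y], the right-hand side is [+oo], as [G y] is not [-oo]. *)
case cE : (fit_cost x y) => [c| |]// _; last first.
  rewrite gt0_muley ?lte_fin// addey ?leey//.
  by case: (G y) (G_ge0 y).
apply/lee_addgt0Pr => e e0.
have : fit_cost x y < (c + e / lambda)%:E.
  by rewrite cE lte_fin ltrDl divr_gt0.
move=> /ereal_inf_lt[_ [[K' t] /= ty <-]]; rewrite lte_fin => tc.
apply: le_trans (t0P _ t) _; rewrite /loss ty -EFinM -addeA leeD2l// -EFinD lee_fin.
rewrite -ler_pdivlMl// (le_trans (ltW tc))// mulrDr mulKf ?gt_eqF//.
by rewrite [X in (_ + X)%R]mulrC.
Qed.

(** [loss t0] is squeezed: it is at least the objective at [lip_network t0], and at most the
    objective at any [f], since [fit_cost] lies below [RTV2]. *)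
Lemma optimal_solves K (t0 : params R d K) :
  (forall K (t : params R d K), loss t0 <= loss t) ->
  minimizers (RBV2 R d)
    (fun f : Lip R d => G (evaluation x f) + lambda%:E * RTV2 f) (lip_network t0).
Proof.
have l0 : 0 <= lambda%:E by rewrite lee_fin ltW.
move=> t0P; split=> [|f _].
  exact: le_lt_trans (RTV2_network_le t0) (ltry _).
apply: (@le_trans _ _ (loss t0)).
  by rewrite leeD2l// EFinM lee_wpmul2l// RTV2_network_le.
apply: le_trans (optimal_le _ _ (evaluation x f) t0P) _.
by rewrite leeD2l// lee_wpmul2l// fit_cost_le_RTV2.
Qed.

End Minimization.

Theorem theorem8p4 (R : realType) (d N : nat) (x : 'I_N -> 'rV[R]_d)
    (x_distinct : injective x)
    (aff_inj : set_inj (affine_functions R d) (evaluation x))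
    (G : 'rV[R]_N -> \bar R)
    (G_ge0 : forall y, 0 <= G y)
    (G_proper : proper_fun G)
    (G_lsc : lower_semicontinuous G)
    (G_coercive : coercive G)
    (lambda : R) (lambda_gt0 : (0 < lambda)%R) :
  let solP : set (Lip R d) := minimizers (RBV2 R d)
    (fun f : Lip R d => G (evaluation x f) + lambda%:E * RTV2 f) in
  let solK (K : nat) : set (params R d K) := minimizers setT
    (fun theta : params R d K => G (evaluation x (network theta)) +
       (lambda / 2 * \sum_(j < K)
          (`|outer theta j| ^+ 2 + enorm (inner theta j) ^+ 2))%:E) in
  [/\ solP !=set0,
      exists f : Lip R d, solP f /\
        exists2 K : nat, (K <= N)%N &
          exists theta : params R d K, forall z, f z = network theta z &
      forall K : nat, (N <= K)%N ->
        solK K !=set0 /\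
        forall theta : params R d K, solK K theta -> solP (lip_network theta)].
Proof.
move=> solP solK.
pose L K (t : params R d K) := loss x G lambda t.
(* The factor [1 / 2] is part of [cost], so the objective of width [K] is [loss]. *)
have solKE K (t : params R d K) : solK K t <->
    forall t' : params R d K, L _ t <= L _ t'.
  have lossE t' : L K t' = G (evaluation x (network t')) + (lambda / 2 *
      \sum_(j < K) (`|outer t' j| ^+ 2 + enorm (inner t' j) ^+ 2))%:E.
    by rewrite /L /loss /cost mulrA.
  split=> [[_ tP] t'|tP]; first by rewrite !lossE; exact: tP.
  by split=> // t' _; rewrite -!lossE.
have loss_resize K K' (t : params R d K) : (N <= K')%N ->
    exists t' : params R d K', L _ t' <= L _ t.
  move=> /(resize x _ _ t)[t' [ft' ct']]; exists t'.
  by rewrite /L /loss ft' leeD2l// lee_fin ler_pM2l.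
have [t0 t0P] := optimal_network x aff_inj G lambda G_ge0
  G_lsc G_coercive lambda_gt0.
have solves K (t : params R d K) := optimal_solves x aff_inj G lambda
  G_ge0 lambda_gt0 K t.
have sol0 : solP (lip_network t0) by exact: solves.
split; first by exists (lip_network t0).
  by exists (lip_network t0); split=> //; exists N => //; exists t0.
move=> K NK; split.
  have [t tt0] := loss_resize _ _ t0 NK; exists t; apply/solKE => t'.
  exact: le_trans tt0 (t0P _ _).
(* Every network resizes to width [K] without increasing the loss, so a solution of width [K] is
   optimal among all widths. *)
move=> t /solKE tP; apply: solves => K' t'.
by have [t'' /(le_trans (tP _))] := loss_resize _ _ t' NK.
Qed.
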